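(* Let $h>0$, let $\vartheta\in[0,1)$ and let $$\Delta\tau_{\mathrm{OPT}}(\vartheta)=\arg\min_{\Delta\tau>0}\ \sup_{\pi/2<\alpha<\pi}\left|G(\alpha,\vartheta,\Delta\tau)\right|$$ be the optimal relaxation parameter for Neumann boundary conditions in 2D. Then $$\frac{\Delta\tau_{\mathrm{OPT}}(\vartheta)}{h}=\frac{2}{G_0(\pi/2,\vartheta)+G_0(\pi,\vartheta)}.$$
   Context: Here $h>0$ is the grid spacing. For $\alpha\in[0,\pi]$ put $p(\alpha)=\cosh^{-1}(2-\cos\alpha)$, where $\cosh^{-1}:[1,\infty)\to[0,\infty)$ is the inverse of $\cosh$ on $[0,\infty)$. For $\vartheta\in[0,1)$ define the Neumann coefficients $$c_{-2}(\vartheta)=\tfrac12-\vartheta,\quad c_{-1}(\vartheta)=2(\vartheta-1),\quad c_0(\vartheta)=\tfrac32-\vartheta,$$ and set $$G_0(\alpha,\vartheta)=\sum_{r=0}^{2}c_{-r}(\vartheta)\,e^{-r\,p(\alpha)},\qquad G(\alpha,\vartheta,\Delta\tau)=1-\frac{\Delta\tau}{h}\,G_0(\alpha,\vartheta)\quad(\Delta\tau>0).$$ ($G$ is the amplification factor of the tangential Fourier mode $e^{\mathbf{i}\alpha y/h}$ under one relaxation of the ghost values.) *)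

(* Defs.v *)
From HB Require Import structures.
From mathcomp Require Import all_boot all_order all_algebra.
From mathcomp Require Import all_classical all_reals all_analysis.

Set Implicit Arguments.
Unset Strict Implicit.
Unset Printing Implicit Defensive.

Import Order.TTheory GRing.Theory Num.Theory.
Import numFieldNormedType.Exports.

Local Open Scope classical_set_scope.
Local Open Scope ring_scope.

Definition cosh {R : realType} (x : R) : R := (expR x + expR (- x)) / 2.

(* Only meaningful on [1, +oo[, the image of [0, +oo[ under cosh; the function
   [fun=> 0] is the default value outside that image. *)
Definition arccosh {R : realType} : R -> R :=
  'pinv_(fun=> 0) [set x : R | 0 <= x] (@cosh R).

Definition decay {R : realType} (alpha : R) : R := arccosh (2 - cos alpha).

(* [neumann_coef theta r] is the coefficient c_{-r}(theta), for r = 0, 1, 2. *)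
Definition neumann_coef {R : realType} (theta : R) (r : 'I_3) : R :=
  match val r with
  | 0%N => 3 / 2 - theta
  | 1%N => 2 * (theta - 1)
  | _ => 1 / 2 - theta
  end.

Definition G0 {R : realType} (alpha theta : R) : R :=
  \sum_(r < 3) neumann_coef theta r * expR (- (r%:R * decay alpha)).

Definition G {R : realType} (h alpha theta dtau : R) : R :=
  1 - dtau / h * G0 alpha theta.

(* The supremum is taken in the extended reals, so that it needs no
   boundedness side condition. *)
Definition sup_absG {R : realType} (h theta dtau : R) : \bar R :=
  ereal_sup [set `|G h alpha theta dtau|%:E
            | alpha in [set alpha : R | pi / 2 < alpha < pi]].

Definition argmin_set {R : realType} (D : set R) (F : R -> \bar R) : set R :=
  [set x | D x /\ forall y, D y -> (F x <= F y)%E].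

(* Main.v *)
Require Import Defs.
From HB Require Import structures.
From mathcomp Require Import all_boot all_order all_algebra.
From mathcomp Require Import all_classical all_reals all_analysis.
From mathcomp Require Import ring lra.

Import Order.TTheory GRing.Theory Num.Theory.
Import numFieldNormedType.Exports.

Local Open Scope classical_set_scope.
Local Open Scope ring_scope.

(** With z = exp (- p(alpha)) the symbol is the quadratic
    (1 - z) ((3/2 - theta) - (1/2 - theta) z), which vanishes at z = 1 and is
    strictly decreasing on ]0, 1] whenever 0 <= theta < 1.  Since cos decreases
    on [0, pi] and the inverse of cosh increases, z decreases with alpha, so
    G0 increases strictly on [0, pi] from the value 0 at alpha = 0 (lemmas
    [G0_incr], [G0_at0]).  Put m = G0 (pi / 2) and M = G0 pi: then 0 < m, and
    on ]pi / 2, pi[ the symbol lies between m and M and, being continuous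
    ([continuous_G0]), comes arbitrarily close to both.

    What remains is a Chebyshev equioscillation argument in one dimension
    ([argmin_sup_absB]): for s = dtau / h, the number |1 - s g| is largest at
    the ends of [m, M], where it equals |1 - s m| or |1 - s M|.  The first
    dominates for small s and the second for large s, and the two balance
    exactly when 1 - s m = s M - 1, that is at s = 2 / (m + M), with common
    value (M - m) / (M + m).  Any other s makes one of them strictly larger. *)

Lemma argmin_strict_min {R : realType} (D : set R) (F : R -> \bar R) (x : R) :
  D x -> (forall y, D y -> y != x -> (F x < F y)%E) -> argmin_set D F = [set x].
Proof.
move=> Dx minx; apply/seteqP; split=> [y [Dy miny] | _ ->] /=.
  apply/eqP; apply/negPn/negP => /(minx y Dy).
  by rewrite ltNge miny.
split=> // y Dy; have [->|/(minx y Dy)/ltW//] := eqVneq y x.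
exact: lexx.
Qed.

(** The bounds m and M need only be approached by g, not attained: a step other
    than the balanced one exceeds the optimal value (M - m) / (m + M) by a
    positive margin at m or at M, hence also at some value of g near it. *)
Lemma argmin_sup_absB {R : realType} {T : Type} (D : set T) (g : T -> R)
    (h m M : R) : 0 < h -> 0 < m ->
    (forall a, D a -> m <= g a <= M) ->
    (forall v, m < v -> exists2 a, D a & g a < v) ->
    (forall v, v < M -> exists2 a, D a & v < g a) ->
  argmin_set [set t : R | 0 < t]
    (fun t => ereal_sup [set `|1 - t / h * g a|%:E | a in D])
  = [set 2 / (m + M) * h].
Proof.
move=> h0 m0 gD gm gM.
have mM : m <= M.
  have [|a /gD /andP[ma aM] _] := gm (m + 1); first by rewrite ltrDl.
  exact: le_trans ma aM.
have s0 : 0 < m + M by lra.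
apply: argmin_strict_min => [/=|t /= t0 tne]; first by rewrite mulr_gt0 ?divr_gt0.
apply: (@le_lt_trans _ _ ((M - m) / (m + M))%:E).
  apply/ereal_supP => _ [a /gD /andP[ma aM] <-].
  rewrite lee_fin mulfK ?gt_eqF//.
  have -> : 1 - 2 / (m + M) * g a = (m + M - 2 * g a) / (m + M).
    by field; rewrite gt_eqF.
  rewrite normf_div (gtr0_norm s0).
  by rewrite ler_pM2r ?invr_gt0// ler_norml; lra.
(* A single point above (M - m) / (m + M) suffices, because that number bounds
   the supremum at the optimal step. *)
suff [a Da lta] : exists2 a, D a & (M - m) / (m + M) < `|1 - t / h * g a|.
  apply: (@lt_le_trans _ _ `|1 - t / h * g a|%:E); first by rewrite lte_fin.
  by apply: ereal_sup_ubound; exists a.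
have sE : t / h != 2 / (m + M).
  by apply/eqP => sE; move/eqP: tne; apply; rewrite -sE divfK// gt_eqF.
have : 0 < t / h by rewrite divr_gt0.
move: (t / h) sE => s sE sgt0.
have e1 : (M - m) / (m + M) = 1 - 2 / (m + M) * m by field; rewrite gt_eqF.
have e2 : (M - m) / (m + M) = 2 / (m + M) * M - 1 by field; rewrite gt_eqF.
have [lts|gts|/eqP] := ltgtP s (2 / (m + M)); last by rewrite (negbTE sE).
(* Short step: 1 - s g a exceeds (M - m) / (m + M) = 1 - 2 m / (m + M) as soon
   as g a < 2 m / ((m + M) s), a threshold which is above m. *)
- have [|a Da lta] := gm (2 / (m + M) * m / s).
    by rewrite ltr_pdivlMr// mulrC ltr_pM2r.
  exists a => //; rewrite e1; apply: lt_le_trans (ler_norm _).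
  by move: lta; rewrite ltr_pdivlMr// mulrC; lra.
(* Long step: symmetrically, s g a - 1 is too large once g a exceeds
   2 M / ((m + M) s), a threshold which is below M. *)
- have [|a Da lta] := gM (2 / (m + M) * M / s).
    by rewrite ltr_pdivrMr// [ltRHS]mulrC ltr_pM2r// (lt_le_trans m0).
  exists a => //; rewrite e2 -normrN; apply: lt_le_trans (ler_norm _).
  by move: lta; rewrite ltr_pdivrMr// mulrC; lra.
Qed.

(** The partial inverse is characterised by these two facts once c is known to
    be a value of cosh; the logarithm of c + sqrt (c^2 - 1) is a preimage, as
    the reciprocal of that number is c - sqrt (c^2 - 1). *)
Lemma arccosh_spec {R : realType} (c : R) : 1 <= c ->
  0 <= arccosh c /\ cosh (arccosh c) = c.
Proof.
move=> c1; set r := Num.sqrt (c ^+ 2 - 1).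
have r2 : r ^+ 2 = c ^+ 2 - 1 by rewrite sqr_sqrtr// subr_ge0 expr_ge1//; lra.
have r0 : 0 <= r by exact: sqrtr_ge0.
have img : (@cosh R @` [set x | 0 <= x]) c.
  exists (ln (c + r)) => /=; first by rewrite ln_ge0//; lra.
  rewrite /cosh expRN lnK ?posrE; last by lra.
  have -> : (c + r)^-1 = c - r.
    apply: (@mulfI _ (c + r)); first by rewrite gt_eqF//; lra.
    by rewrite mulfV ?gt_eqF//; [nra|lra].
  by field.
split; last by apply: pinvK; rewrite inE.
suff : (@arccosh R @` (@cosh R @` [set x | 0 <= x])) `<=` [set x | 0 <= x].
  by apply; exists c.
exact: surjpinv_image_sub.
Qed.

(** exp (- x) is the smaller root of u^2 - 2 c u + 1 when cosh x = c and
    0 <= x.  This closed form gives the continuity of the symbol without any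
    study of arccosh as a function. *)
Lemma expRN_arccosh {R : realType} (c : R) : 1 <= c ->
  expR (- arccosh c) = c - Num.sqrt (c ^+ 2 - 1).
Proof.
move=> c1; have [a0 ac] := arccosh_spec c c1.
have u0 : 0 < expR (- arccosh c) by exact: expR_gt0.
have u1 : expR (- arccosh c) <= 1 by rewrite -expR0 ler_expR oppr_le0.
have uv : expR (arccosh c) * expR (- arccosh c) = 1.
  by rewrite expRN mulfV// gt_eqF// expR_gt0.
move: ac uv; rewrite /cosh.
move: (expR (arccosh c)) (expR (- arccosh c)) u0 u1 => v u u0 u1 ac uv.
have -> : c ^+ 2 - 1 = (c - u) ^+ 2 by rewrite -ac; nra.
by rewrite sqrtr_sqr ger0_norm; lra.
Qed.

(** Contrapositive of the monotonicity of cosh on [0, +oo[, which is read off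
    cosh y - cosh x = (e^y - e^x) (1 - e^(-x) e^(-y)) / 2. *)
Lemma expRN_arccosh_decr {R : realType} (c d : R) : 1 <= c -> c < d ->
  expR (- arccosh d) < expR (- arccosh c).
Proof.
move=> c1 cd; have d1 : 1 <= d by lra.
have [c0 cE] := arccosh_spec c c1; have [d0 dE] := arccosh_spec d d1.
rewrite ltr_expR ltrN2 ltNge; apply/negP => dc; move: cd.
apply/negP; rewrite -leNgt -dE -cE /cosh ler_pM2r ?invr_gt0//.
have := expRxMexpNx_1 (arccosh d); have := expRxMexpNx_1 (arccosh c).
have : expR (arccosh d) <= expR (arccosh c) by rewrite ler_expR.
have : expR (- arccosh c) <= 1 by rewrite -expR0 ler_expR oppr_le0.
have : expR (- arccosh d) <= 1 by rewrite -expR0 ler_expR oppr_le0.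
have := expR_gt0 (- arccosh d).
move: (expR (- arccosh d)) (expR (- arccosh c)) => x' y'.
move: (expR (arccosh d)) (expR (arccosh c)) => x y x'0 x'1 y'1 xy yE xE.
rewrite -subr_ge0.
have -> : y + y' - (x + x') = (y - x) * (1 - x' * y').
  have -> : (y - x) * (1 - x' * y') = y - x - (y * y' * x' - x * x' * y').
    by ring.
  by rewrite yE xE; ring.
by rewrite mulr_ge0 ?subr_ge0//; nra.
Qed.

Lemma G0E {R : realType} (alpha theta : R) (z := expR (- decay alpha)) :
  G0 alpha theta = (1 - z) * ((3 / 2 - theta) - (1 / 2 - theta) * z).
Proof.
rewrite /G0 !big_ord_recl big_ord0 /neumann_coef /= /bump /=.
rewrite mul0r oppr0 expR0 addn0 [1%:R * _]mul1r.
have -> : expR (- ((1 + 1)%N%:R * decay alpha)) = z ^+ 2.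
  by rewrite -mulrN expRM_natl.
by rewrite -/z; field.
Qed.

(** The drop from z to w, divided by w - z, is
    2 - 2 theta - (1/2 - theta) (z + w).  As z + w < 2, this is at least 1 if
    theta <= 1/2; for theta > 1/2 both terms are positive. *)
Lemma symbol_decr {R : realType} (theta z w : R) :
    0 <= theta -> theta < 1 -> 0 < z -> z < w -> w <= 1 ->
  (1 - w) * ((3 / 2 - theta) - (1 / 2 - theta) * w)
  < (1 - z) * ((3 / 2 - theta) - (1 / 2 - theta) * z).
Proof.
move=> th0 th1 z0 zw w1; rewrite -subr_gt0.
have -> : (1 - z) * (3 / 2 - theta - (1 / 2 - theta) * z) -
   (1 - w) * (3 / 2 - theta - (1 / 2 - theta) * w) =
  (w - z) * (2 - 2 * theta - (1 / 2 - theta) * (z + w)) by field.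
rewrite mulr_gt0 ?subr_gt0//.
nra.
Qed.

Lemma two_sub_cos_ge1 {R : realType} (alpha : R) : 1 <= 2 - cos alpha.
Proof. by have := cos_le1 alpha; lra. Qed.

Lemma G0_incr {R : realType} (theta a b : R) : 0 <= theta -> theta < 1 ->
  0 <= a -> a < b -> b <= pi -> G0 a theta < G0 b theta.
Proof.
move=> th0 th1 a0 ab bpi; rewrite !G0E; apply: symbol_decr => //.
- exact: expR_gt0.
- apply: expRN_arccosh_decr; first exact: two_sub_cos_ge1.
  by rewrite ltrD2l ltrN2 ltr_cos// in_itv /=; lra.
- rewrite -expR0 ler_expR oppr_le0.
  by have [] := arccosh_spec _ (two_sub_cos_ge1 a).
Qed.

(** Constant data (alpha = 0, z = 1) are annihilated: the coefficients sum to 0,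
    as those of a discrete normal derivative must. *)
Lemma G0_at0 {R : realType} (theta : R) : G0 0 theta = 0 :> R.
Proof.
rewrite G0E /decay cos0 expRN_arccosh; last by lra.
have -> : (2 - 1) ^+ 2 - 1 = 0 :> R by ring.
by rewrite sqrtr0; ring.
Qed.

Lemma continuous_G0 {R : realType} (theta : R) :
  continuous (fun alpha : R => G0 alpha theta).
Proof.
have -> : (fun alpha : R => G0 alpha theta) =
  (fun z => (1 - z) * ((3 / 2 - theta) - (1 / 2 - theta) * z)) \o
  (fun c => c - Num.sqrt (c ^+ 2 - 1)) \o (fun alpha => 2 - cos alpha).
  apply/funext => alpha; rewrite G0E /= expRN_arccosh//.
  exact: two_sub_cos_ge1.
move=> alpha; apply: continuous_comp.
  by apply: cvgB; [exact: cvg_cst|exact: continuous_cos].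
apply: continuous_comp.
  apply: cvgB; first exact: cvg_id.
  apply: (@continuous_comp _ _ _ (fun c : R => c ^+ 2 - 1) Num.sqrt).
    by apply: cvgB; [exact: exprn_continuous|exact: cvg_cst].
  exact: sqrt_continuous.
apply: cvgM; first by apply: cvgB; [exact: cvg_cst|exact: cvg_id].
apply: cvgB; first exact: cvg_cst.
by apply: cvgM; [exact: cvg_cst|exact: cvg_id].
Qed.

Theorem proposition2 (R : realType) (h theta : R)
    (h_gt0 : 0 < h) (theta_ge0 : 0 <= theta) (theta_lt1 : theta < 1) :
  exists dtau_opt : R,
    argmin_set [set dtau : R | 0 < dtau] (sup_absG h theta) = [set dtau_opt] /\
    dtau_opt / h = 2 / (G0 (pi / 2) theta + G0 pi theta).
Proof.
exists (2 / (G0 (pi / 2) theta + G0 pi theta) * h).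
split; last by rewrite mulfK ?gt_eqF.
have pi0 : 0 < pi :> R by exact: pi_gt0.
have pi2 : pi / 2 < pi :> R by lra.
apply: (@argmin_sup_absB R R _ (fun alpha => G0 alpha theta)) => //.
(* Positivity of the lower bound is monotonicity from alpha = 0, where the
   symbol vanishes. *)
- by rewrite -[ltLHS](G0_at0 theta); apply: G0_incr => //; lra.
- by move=> a /= /andP[a1 a2]; apply/andP; split;
    apply/ltW/G0_incr => //; lra.
- move=> v mv.
  have [a /= ] := @filter_ex _ (pi / 2 : R)^'+ _ _ (filterI
    (cvgr_lt _ (cvg_at_right_filter (continuous_G0 theta _)) _ mv)
    (filterI (nbhs_right_gt _) (nbhs_right_lt pi2))).
  by move=> [av [a1 a2]]; exists a => //=; rewrite a1.
- move=> v mv.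
  have [a /= ] := @filter_ex _ (pi : R)^'- _ _ (filterI
    (cvgr_gt _ (cvg_at_left_filter (continuous_G0 theta _)) _ mv)
    (filterI (nbhs_left_lt _) (nbhs_left_gt pi2))).
  by move=> [av [a1 a2]]; exists a => //=; rewrite a2.
Qed.
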